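(* Let $\mathbb{K} \in \{\mathbb{R},\mathbb{C}\}$, $k \ge 2$, and let $F \colon\mathbb{N} \to \mathbb{N}$ be a strictly increasing function. For every $\varepsilon > 0$ and every tensor $\tau \in \mathbb{K}^{[n]^k}$ there exist an integer $t \le \lceil 4/\varepsilon^2\rceil$ and a decomposition $$\tau = \sum_{j < F(t)}\lambda_j(\boldsymbol{u}_{j,1}\otimes\cdots\otimes\boldsymbol{u}_{j,k}) + R + Q,$$ with unit vectors $(\boldsymbol{u}_{j,\ell})_{j,\ell}$ and $\lambda_1, \ldots, \lambda_{F(t)-1} \in \mathbb{R}$ and $$\|R\|_F < \varepsilon\|\tau\|_F \qquad\text{and}\qquad \lambda_{\max}(Q) < \frac{\varepsilon\|\tau\|_F}{\sqrt{F(t+1) - F(t)}}.$$ Moreover, each $(\lambda_j; \boldsymbol{u}_{j,1}, \ldots, \boldsymbol{u}_{j,k})$ may be chosen to be a top eigenpair of the residual tensor $\tau -\sum_{i=1}^{j-1}\lambda_i(\boldsymbol{u}_{i,1}\otimes\cdots\otimes\boldsymbol{u}_{i,k})$. For a symmetric $\tau$ the factors may be chosen equal, i.e. $\boldsymbol{u}_{j,\ell}=\boldsymbol{u}_j$, so that the $j$-th rank-one tensor is $\boldsymbol{u}_j^{\otimes k}$. For $\mathbb{K} = \mathbb{C}$ and for $\mathbb{K} = \mathbb{R}$ with odd $k$ the $\lambda_j$'s can be taken positive.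
   Context: Let $[n]=\{1,\dots,n\}$. A tensor $\tau=(\tau_{i_1\cdots i_k})\in\mathbb{K}^{[n]^k}$ acts as a $k$-linear form $\tau(\boldsymbol{u}_1,\ldots,\boldsymbol{u}_k)=\sum_{i_1,\ldots,i_k\in[n]}\tau_{i_1\cdots i_k}\boldsymbol{u}_1(i_1)\cdots\boldsymbol{u}_k(i_k)$ on $\mathbb{K}^n$ (no conjugation). It is symmetric if $\tau_{i_{\pi(1)}\cdots i_{\pi(k)}}=\tau_{i_1\cdots i_k}$ for every permutation $\pi$ of $[k]$. $\|\cdot\|$ is the Euclidean norm on $\mathbb{K}^n$, and unit vectors are vectors in $\mathbb{K}^n$ of norm $1$. The top eigenvalue of $\tau$ is $\lambda_{\max}(\tau)=\sup|\tau(\boldsymbol{u}_1,\ldots,\boldsymbol{u}_k)|$ over all unit vectors $\boldsymbol{u}_1,\ldots,\boldsymbol{u}_k\in\mathbb{K}^n$. The Frobenius norm is $\|\tau\|_F=\bigl(\sum_{i_1,\ldots,i_k}|\tau_{i_1\cdots i_k}|^2\bigr)^{1/2}$. The rank-one tensor $\boldsymbol{u}_1\otimes\cdots\otimes\boldsymbol{u}_k$ has entries $\boldsymbol{u}_1(i_1)\cdots\boldsymbol{u}_k(i_k)$, and $\boldsymbol{u}^{\otimes k}$ denotes the case of all factors equal to $\boldsymbol{u}$. A tuple $(\lambda;\boldsymbol{u}_1,\ldots,\boldsymbol{u}_k)$ with unit vectors $\boldsymbol{u}_i\in\mathbb{K}^n$, $\lambda=\tau(\overline{\boldsymbol{u}_1},\ldots,\overline{\boldsymbol{u}_k})$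 (entrywise complex conjugates) and $|\lambda|=\lambda_{\max}(\tau)$ is called a top eigenpair of $\tau$. In the decomposition, $R,Q\in\mathbb{K}^{[n]^k}$ are tensors, and the index $j$ of the sum starts at $1$.
   Formalization: The tensor τ is assumed nonzero (for τ = 0 the strict bounds fail); with top eigenpairs, λ_j is positive only where the residual tensor is nonzero (else λ_j = 0), and a decomposition with all λ_j positive is given separately, without the eigenpair property. *)

(* Defs.v *)
From HB Require Import structures.
From mathcomp Require Import all_boot all_order all_algebra all_fingroup.
From mathcomp Require Import complex.
From mathcomp Require Import all_classical all_reals.

Set Implicit Arguments.
Unset Strict Implicit.
Unset Printing Implicit Defensive.

Import Order.TTheory GRing.Theory Num.Theory.

Local Open Scope ring_scope.

Inductive base_field := RealField | ComplexField.

Definition scalar_type (R : realType) (K : base_field) : numFieldType :=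
  match K with RealField => R | ComplexField => R[i] end.

(* The library norm on [R[i]] takes its values in [R[i]]; suprema are taken in [R], so
   the [R]-valued modulus is used. *)
Definition modulus (R : realType) (K : base_field) : scalar_type R K -> R :=
  match K return scalar_type R K -> R with
  | RealField => fun x => `|x|
  | ComplexField => fun z => ComplexField.Normc.normc z
  end.

Definition conj_scalar (R : realType) (K : base_field) : scalar_type R K -> scalar_type R K :=
  match K return scalar_type R K -> scalar_type R K with
  | RealField => fun x => x
  | ComplexField => fun z => conjc z
  end.

Definition of_real (R : realType) (K : base_field) : R -> scalar_type R K :=
  match K return R -> scalar_type R K with
  | RealField => fun x => x
  | ComplexField => fun x => real_complex R x
  end.

Section Tensors.
Context {R : realType} {K : base_field} {n k : nat}.

(* Entries are taken in the regular module [_^o] so that tensors inherit the pointwise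
   vector space structure. *)
Definition tensor : Type := {ffun {ffun 'I_k -> 'I_n} -> (scalar_type R K)^o}.

Definition unit_vector (v : 'rV[scalar_type R K]_n) : Prop :=
  Num.sqrt (\sum_(i < n) modulus (v 0 i) ^+ 2) = 1.

Definition tensor_form (tau : tensor) (u : 'I_k -> 'rV[scalar_type R K]_n) : scalar_type R K :=
  \sum_(i : {ffun 'I_k -> 'I_n}) tau i * \prod_(l < k) u l 0 (i l).

Definition rank_one (u : 'I_k -> 'rV[scalar_type R K]_n) : tensor :=
  [ffun i : {ffun 'I_k -> 'I_n} => \prod_(l < k) u l 0 (i l)].

Definition symmetric_tensor (tau : tensor) : Prop :=
  forall (s : 'S_k) (i : {ffun 'I_k -> 'I_n}), tau [ffun l => i (s l)] = tau i.

Definition lambda_max (tau : tensor) : R :=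
  sup [set modulus (tensor_form tau u) |
        u in [set u : 'I_k -> 'rV[scalar_type R K]_n | forall l, unit_vector (u l)]]%classic.

Definition frobenius_norm (tau : tensor) : R :=
  Num.sqrt (\sum_(i : {ffun 'I_k -> 'I_n}) modulus (tau i) ^+ 2).

Definition top_eigenpair (tau : tensor) (lam : scalar_type R K)
    (u : 'I_k -> 'rV[scalar_type R K]_n) : Prop :=
  [/\ forall l, unit_vector (u l),
      lam = tensor_form tau (fun l => map_mx (@conj_scalar R K) (u l)) &
      modulus lam = lambda_max tau].

(* [lam] and [u] are only meaningful at the indices 1, 2, ...; the value at 0 is unused. *)
Definition partial_sum (lam : nat -> R) (u : nat -> 'I_k -> 'rV[scalar_type R K]_n)
    (m : nat) : tensor :=
  \sum_(1 <= j < m) of_real K (lam j) *: rank_one (u j).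

Definition regularity_decomposition (F : nat -> nat) (eps : R) (tau : tensor) (t : nat)
    (lam : nat -> R) (u : nat -> 'I_k -> 'rV[scalar_type R K]_n) (Rem Q : tensor) : Prop :=
  [/\ tau = partial_sum lam u (F t) + Rem + Q,
      forall j l, (1 <= j < F t)%N -> unit_vector (u j l),
      frobenius_norm Rem < eps * frobenius_norm tau &
      lambda_max Q < eps * frobenius_norm tau / Num.sqrt (F t.+1 - F t)%:R].

Definition equal_factors (F : nat -> nat) (t : nat)
    (u : nat -> 'I_k -> 'rV[scalar_type R K]_n) : Prop :=
  forall j, (1 <= j < F t)%N ->
    exists v : 'rV[scalar_type R K]_n, forall l, u j l = v.

End Tensors.

Arguments tensor : clear implicits.

(* Main.v *)
Require Import Defs.
From HB Require Import structures.
From mathcomp Require Import all_boot all_order all_algebra all_fingroup.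
From mathcomp Require Import complex.
From mathcomp Require Import all_classical all_reals.
From mathcomp Require Import topology normedtype derive.
From mathcomp Require Import ring lra.

(* Run the greedy algorithm: subtract from the residual r_m a top eigenpair
   l_m X_m, so that |r_(m+1)|^2 = |r_m|^2 - l_m^2.  As the total energy is |tau|^2,
   some block [F t, F (t+1)) with t <= ceil (4 / eps^2) carries energy less than
   eps^2 |tau|^2 / 3.  Let b minimise |l_m| over that block and put Q = r_b and
   Rem = r_a - r_b, where a is the start of the block.  Minimality bounds
   lambda_max Q = |l_b|, and also |<Rem, r_b>| <= sum |l_m| |l_b| <= sum l_m^2, whence
   |Rem|^2 <= 3 (|r_a|^2 - |r_b|^2).

   For symmetric tensors a top eigenpair with equal factors is needed (Banach).  Among
   the maximisers of |tau(u_1, ..., u_k)| take one maximising sum |<u_a, u_b>|^2.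
   Polarisation of tau in two slots x, y together with the parallelogram law shows that
   replacing both by the normalised x + y, or both by the normalised x - y, gives again
   a maximiser; comparing the second functional forces |<x, y>| = 1, so that all u_a are
   collinear. *)

Set Implicit Arguments.
Unset Strict Implicit.
Unset Printing Implicit Defensive.

Import Order.TTheory GRing.Theory Num.Theory.
Import numFieldNormedType.Exports.

Local Open Scope ring_scope.

(** * Real and imaginary parts of scalars *)

Definition re_scalar (R : realType) (K : base_field) : scalar_type R K -> R :=
  match K return scalar_type R K -> R with
  | RealField => fun x => x
  | ComplexField => fun z => complex.Re z
  end.

Definition im_scalar (R : realType) (K : base_field) : scalar_type R K -> R :=
  match K return scalar_type R K -> R with
  | RealField => fun=> 0
  | ComplexField => fun z => complex.Im z
  end.

(** Real scalars drop the second coordinate, so that one space of real coordinates parametrises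
    vectors over either field. *)
Definition mk_scalar (R : realType) (K : base_field) : R -> R -> scalar_type R K :=
  match K return R -> R -> scalar_type R K with
  | RealField => fun a _ => a
  | ComplexField => fun a b => Complex a b
  end.

Section Scalars.
Context {R : realType} {K : base_field}.
Implicit Types (x y z : scalar_type R K) (a b : R).

Lemma re_scalarB : {morph @re_scalar R K : x y / x - y}.
Proof. by rewrite /re_scalar; case: K => [x y|[a b] [c d]]. Qed.

HB.instance Definition _ :=
  GRing.isZmodMorphism.Build (scalar_type R K) R (@re_scalar R K) re_scalarB.

Lemma im_scalarB : {morph @im_scalar R K : x y / x - y}.
Proof. by rewrite /im_scalar; case: K => [x y|[a b] [c d]] //=; rewrite subr0. Qed.

HB.instance Definition _ :=
  GRing.isZmodMorphism.Build (scalar_type R K) R (@im_scalar R K) im_scalarB.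

Lemma re_scalarM x y :
  re_scalar (x * y) = re_scalar x * re_scalar y - im_scalar x * im_scalar y.
Proof.
rewrite /re_scalar /im_scalar; case: K x y => [|[a b] [c d]] //= x y.
by rewrite mulr0 subr0.
Qed.

Lemma im_scalarM x y :
  im_scalar (x * y) = re_scalar x * im_scalar y + im_scalar x * re_scalar y.
Proof.
rewrite /re_scalar /im_scalar; case: K x y => [|[a b] [c d]] //= x y.
by rewrite mulr0 mul0r addr0.
Qed.

Lemma mk_scalarK x : mk_scalar K (re_scalar x) (im_scalar x) = x.
Proof. by rewrite /mk_scalar /re_scalar /im_scalar; case: K x => // -[]. Qed.

Lemma re_mk_scalar a b : re_scalar (mk_scalar K a b) = a.
Proof. by rewrite /mk_scalar /re_scalar; case: K. Qed.

Lemma im_mk_scalar a b :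
  im_scalar (mk_scalar K a b) = if K is ComplexField then b else 0.
Proof. by rewrite /mk_scalar /im_scalar; case: K. Qed.

Lemma scalar_inj x y :
  re_scalar x = re_scalar y -> im_scalar x = im_scalar y -> x = y.
Proof. by move=> e1 e2; rewrite -(mk_scalarK x) -(mk_scalarK y) e1 e2. Qed.

Lemma modulus_ge0 x : 0 <= modulus x.
Proof.
by rewrite /modulus; case: K x => [x|[a b]]; rewrite ?normr_ge0 ?sqrtr_ge0.
Qed.

Lemma modulus_sqr x : modulus x ^+ 2 = re_scalar x ^+ 2 + im_scalar x ^+ 2.
Proof.
rewrite /modulus /re_scalar /im_scalar; case: K x => [x|[a b]] /=.
  by rewrite expr0n addr0 real_normK ?num_real.
by rewrite sqr_sqrtr // addr_ge0 // sqr_ge0.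
Qed.

Lemma modulus_eq0 x : modulus x = 0 -> x = 0.
Proof.
move=> x0; have /eqP := modulus_sqr x.
rewrite x0 expr0n /= eq_sym paddr_eq0 ?sqr_ge0 // !sqrf_eq0 => /andP[/eqP ? /eqP ?].
by apply: scalar_inj; rewrite raddf0.
Qed.

Lemma modulus0 : modulus (0 : scalar_type R K) = 0.
Proof.
by apply/eqP; rewrite -sqrf_eq0 modulus_sqr !raddf0 expr0n addr0.
Qed.

Lemma modulusM x y : modulus (x * y) = modulus x * modulus y.
Proof.
apply/eqP; rewrite -(@eqrXn2 _ 2) ?mulr_ge0 ?modulus_ge0 //.
rewrite exprMn !modulus_sqr re_scalarM im_scalarM; apply/eqP; ring.
Qed.

Lemma ler_re_modulus x : `|re_scalar x| <= modulus x.
Proof.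
rewrite -(@ler_pXn2r _ 2) ?nnegrE ?normr_ge0 ?modulus_ge0 // modulus_sqr.
by rewrite real_normK ?num_real // lerDl sqr_ge0.
Qed.

Lemma ler_modulusD x y : modulus (x + y) <= modulus x + modulus y.
Proof.
rewrite /modulus; case: K x y => x y; first exact: ler_normD.
exact: le_normcD.
Qed.

Lemma modulusN x : modulus (- x) = modulus x.
Proof.
apply/eqP; rewrite -(@eqrXn2 _ 2) ?modulus_ge0 //.
by rewrite !modulus_sqr !raddfN !sqrrN.
Qed.

Lemma modulus_parallelogram x y :
  modulus (x + y) ^+ 2 + modulus (x - y) ^+ 2 =
  2 * (modulus x ^+ 2 + modulus y ^+ 2).
Proof. rewrite !modulus_sqr !raddfB !raddfD /=; ring. Qed.

Lemma conj_scalarB : {morph @conj_scalar R K : x y / x - y}.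
Proof. by rewrite /conj_scalar; case: K => //= x y; rewrite rmorphB. Qed.

HB.instance Definition _ :=
  GRing.isZmodMorphism.Build (scalar_type R K) (scalar_type R K)
    (@conj_scalar R K) conj_scalarB.

Lemma conj_scalar_monoid : monoid_morphism (@conj_scalar R K).
Proof.
rewrite /conj_scalar; case: K => //=; split=> [|x y]; first exact: rmorph1.
exact: rmorphM.
Qed.

HB.instance Definition _ :=
  GRing.isMonoidMorphism.Build (scalar_type R K) (scalar_type R K)
    (@conj_scalar R K) conj_scalar_monoid.

Lemma conj_scalarK : involutive (@conj_scalar R K).
Proof. by rewrite /conj_scalar; case: K => // x; apply: conjcK. Qed.

Lemma re_conj x : re_scalar (conj_scalar x) = re_scalar x.
Proof. by rewrite /re_scalar /conj_scalar; case: K x => // -[]. Qed.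

Lemma im_conj x : im_scalar (conj_scalar x) = - im_scalar x.
Proof.
by rewrite /im_scalar /conj_scalar; case: K x => [|[]] //= _; rewrite oppr0.
Qed.

Lemma modulus_conj x : modulus (conj_scalar x) = modulus x.
Proof.
apply/eqP; rewrite -(@eqrXn2 _ 2) ?modulus_ge0 //.
by rewrite !modulus_sqr re_conj im_conj sqrrN.
Qed.

Lemma re_mul_conj x : re_scalar (x * conj_scalar x) = modulus x ^+ 2.
Proof. rewrite modulus_sqr re_scalarM re_conj im_conj; ring. Qed.

Lemma of_realB : {morph @of_real R K : x y / x - y}.
Proof. by rewrite /of_real; case: K => //= x y; rewrite rmorphB. Qed.

HB.instance Definition _ :=
  GRing.isZmodMorphism.Build R (scalar_type R K) (of_real K) of_realB.

Lemma of_real_monoid : monoid_morphism (@of_real R K).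
Proof.
rewrite /of_real; case: K => //=; split=> [|x y]; first exact: rmorph1.
exact: rmorphM.
Qed.

HB.instance Definition _ :=
  GRing.isMonoidMorphism.Build R (scalar_type R K) (of_real K) of_real_monoid.

Lemma re_of_real a : re_scalar (of_real K a) = a.
Proof. by rewrite /re_scalar /of_real; case: K. Qed.

Lemma im_of_real a : im_scalar (of_real K a) = 0.
Proof. by rewrite /im_scalar /of_real; case: K. Qed.

Lemma conj_of_real a : conj_scalar (of_real K a) = of_real K a.
Proof. by apply: scalar_inj; rewrite ?re_conj // im_conj im_of_real oppr0. Qed.

Lemma re_of_realM a x : re_scalar (of_real K a * x) = a * re_scalar x.
Proof. by rewrite re_scalarM re_of_real im_of_real mul0r subr0. Qed.

Lemma modulus_of_real a : modulus (of_real K a) = `|a|.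
Proof.
apply/eqP; rewrite -(@eqrXn2 _ 2) ?modulus_ge0 ?normr_ge0 //.
by rewrite modulus_sqr re_of_real im_of_real expr0n addr0 real_normK ?num_real.
Qed.

Lemma mul_conj_scalar x : x * conj_scalar x = of_real K (modulus x ^+ 2).
Proof.
apply: scalar_inj; rewrite ?re_mul_conj ?re_of_real //.
rewrite im_scalarM re_conj im_conj im_of_real; ring.
Qed.

Lemma modulus1 : modulus (1 : scalar_type R K) = 1.
Proof. by rewrite -[1](rmorph1 (of_real K)) modulus_of_real normr1. Qed.

Lemma modulusX x m : modulus (x ^+ m) = modulus x ^+ m.
Proof.
by elim: m => [|m IH]; rewrite ?expr0 ?modulus1 // !exprS modulusM IH.
Qed.

Lemma modulus_prod (I : finType) (P : pred I) (f : I -> scalar_type R K) :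
  modulus (\prod_(i | P i) f i) = \prod_(i | P i) modulus (f i).
Proof. exact: (big_morph _ modulusM modulus1). Qed.

End Scalars.

(* In the complex case a [k]-th root of the inverse phase; a real phase is a sign, which
   has a [k]-th root for odd [k]. *)
Lemma exists_phase (R : realType) (K : base_field) (k : nat) (z : scalar_type R K) : (0 < k)%N ->
  exists w : scalar_type R K, exists r : R,
    [/\ modulus w = 1, w ^+ k * z = of_real K r &
        (K = ComplexField \/ (K = RealField /\ odd k) -> 0 <= r)].
Proof.
move=> k0.
have [z0|z_neq0] := eqVneq z 0.
  by exists 1, 0; rewrite modulus1 z0 mulr0 raddf0.
have mz0 : modulus z != 0 by apply: contraNneq z_neq0 => /modulus_eq0 ->.
(* Taking moduli shows that any solution [w] has modulus 1. A complex solution always exists; if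
   there is no real one, [w = 1] and [r = z] are used, and for odd [k] a negative [z] is impossible
   because [-1] would be a solution. *)
have [[w]|nw] := pselect (exists w, w ^+ k * z = of_real K (modulus z)).
  move=> wE; exists w, (modulus z); split=> //; last by rewrite modulus_ge0.
  have /(congr1 (@modulus R K)) := wE.
  rewrite modulusM modulusX modulus_of_real ger0_norm ?modulus_ge0 //.
  move/(canRL (mulfK mz0)); rewrite divff // => /eqP.
  by rewrite pexpr_eq1 ?modulus_ge0 // => /eqP.
case: K z z_neq0 mz0 nw => [|] z z_neq0 mz0 nw.
- exists 1, z; split; rewrite ?modulus1 ?expr1n ?mul1r // => -[//|[_ ok]].
  rewrite leNgt; apply/negP => zlt0; apply: nw; exists (-1).
  by rewrite -signr_odd ok expr1 mulN1r /= ltr0_norm.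
- exfalso; apply: nw; exists (k.-root (of_real ComplexField (modulus z) / z)).
  by rewrite rootCK // divfK.
Qed.

(** * Hermitian products *)

Section Hermitian.
Context {R : realType} {K : base_field} {I : finType}.
Implicit Types (f g h : I -> scalar_type R K) (c : scalar_type R K).

Definition hdot f g : scalar_type R K := \sum_i f i * conj_scalar (g i).

Definition sqnorm f : R := \sum_i modulus (f i) ^+ 2.

Lemma eq_sqnorm f g : f =1 g -> sqnorm f = sqnorm g.
Proof. by move=> e; apply: eq_bigr => i _; rewrite e. Qed.

Lemma sqnorm_ge0 f : 0 <= sqnorm f.
Proof. by apply: sumr_ge0 => i _; rewrite sqr_ge0. Qed.

Lemma sqnorm_eq0 f : sqnorm f = 0 -> forall i, f i = 0.
Proof.
move=> /eqP; rewrite psumr_eq0 => [/allP f0 i|i _]; last by rewrite sqr_ge0.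
have := f0 i; rewrite mem_index_enum => /(_ isT) /=.
by rewrite sqrf_eq0 => /eqP /modulus_eq0.
Qed.

Lemma sqnormZ c f : sqnorm (fun i => c * f i) = modulus c ^+ 2 * sqnorm f.
Proof. by rewrite mulr_sumr; apply: eq_bigr => i _; rewrite modulusM exprMn. Qed.

Lemma sqnorm_conj f : sqnorm (fun i => conj_scalar (f i)) = sqnorm f.
Proof. by apply: eq_bigr => i _; rewrite modulus_conj. Qed.

Lemma sqnorm_parallelogram f g :
  sqnorm (fun i => f i + g i) + sqnorm (fun i => f i - g i) =
  2 * (sqnorm f + sqnorm g).
Proof.
rewrite -!big_split mulr_sumr; apply: eq_bigr => i _ /=.
exact: modulus_parallelogram.
Qed.

Lemma hdotBZl c f g h :
  hdot (fun i => f i - c * g i) h = hdot f h - c * hdot g h.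
Proof.
by rewrite mulr_sumr -sumrB; apply: eq_bigr => i _; rewrite mulrBl mulrA.
Qed.

Lemma hdotDl f g h : hdot (fun i => f i + g i) h = hdot f h + hdot g h.
Proof. by rewrite -big_split; apply: eq_bigr => i _; rewrite mulrDl. Qed.

Lemma hdotBl f g h : hdot (fun i => f i - g i) h = hdot f h - hdot g h.
Proof. by rewrite -sumrB; apply: eq_bigr => i _; rewrite mulrBl. Qed.

Lemma hdotZl c f g : hdot (fun i => c * f i) g = c * hdot f g.
Proof. by rewrite mulr_sumr; apply: eq_bigr => i _; rewrite mulrA. Qed.

Lemma hdotC f g : hdot f g = conj_scalar (hdot g f).
Proof.
rewrite raddf_sum; apply: eq_bigr => i _ /=.
by rewrite rmorphM /= conj_scalarK mulrC.
Qed.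

Lemma re_hdotC f g : re_scalar (hdot f g) = re_scalar (hdot g f).
Proof. by rewrite hdotC re_conj. Qed.

Lemma hdot_self f : hdot f f = of_real K (sqnorm f).
Proof.
by rewrite raddf_sum; apply: eq_bigr => i _; rewrite mul_conj_scalar.
Qed.

Lemma sqnormE f : sqnorm f = re_scalar (hdot f f).
Proof. by rewrite hdot_self re_of_real. Qed.

(** Pythagoras for the projection along a unit vector. It yields the Cauchy-Schwarz inequality, its
    equality case, and the energy lost in a greedy step. *)
Lemma sqnorm_proj f g : sqnorm g = 1 ->
  sqnorm (fun i => f i - hdot f g * g i) = sqnorm f - modulus (hdot f g) ^+ 2.
Proof.
move=> g1; set c := hdot f g.
rewrite !sqnormE hdotBZl (hdotC f) (hdotC g) !hdotBZl.
rewrite !hdot_self g1 rmorph1 (hdotC g f) -/c !raddfB /= !rmorphM /=.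
rewrite !conj_scalarK conj_of_real rmorph1 mulr1 subrr mulr0 raddf0 subr0.
by rewrite mulrC re_mul_conj.
Qed.

End Hermitian.

(** * Unit vectors, normalisation and collinearity *)

Section Vectors.
Context {R : realType} {K : base_field} {n : nat}.
Implicit Types (x y z : 'rV[scalar_type R K]_n).

Lemma unit_vectorE x : unit_vector x <-> sqnorm (x 0) = 1.
Proof.
rewrite /unit_vector -/(sqnorm (x 0)); split=> [e|->]; last by rewrite sqrtr1.
by rewrite -(sqr_sqrtr (sqnorm_ge0 (x 0))) e expr1n.
Qed.

Lemma unit_vector_conj x :
  unit_vector x -> unit_vector (map_mx (@conj_scalar R K) x).
Proof.
move=> /unit_vectorE x1; apply/unit_vectorE; rewrite -x1 -[RHS]sqnorm_conj.
by apply: eq_sqnorm => i; rewrite mxE.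
Qed.

Lemma unit_vectorZ c x : modulus c = 1 -> unit_vector x -> unit_vector (c *: x).
Proof.
move=> c1 /unit_vectorE x1; apply/unit_vectorE.
rewrite -[RHS]x1 -[RHS]mul1r -[in RHS](expr1n _ 2) -c1 -sqnormZ.
by apply: eq_sqnorm => i; rewrite mxE.
Qed.

Lemma unit_vector_delta (i : 'I_n) :
  unit_vector (delta_mx 0 i : 'rV[scalar_type R K]_n).
Proof.
apply/unit_vectorE; rewrite /sqnorm (bigD1 i) //= mxE !eqxx modulus1 expr1n.
rewrite big1 ?addr0 // => j /negPf ij.
by rewrite mxE ij andbF modulus0 expr0n.
Qed.

(** A zero vector is written as 0 times a basis vector, which is where [0 < n] enters. *)
Lemma unit_vector_polar z : (0 < n)%N ->
  exists2 w, unit_vector w & z = of_real K (Num.sqrt (sqnorm (z 0))) *: w.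
Proof.
move=> n0; have [z0|z0] := eqVneq (sqnorm (z 0)) 0.
  exists (delta_mx 0 (Ordinal n0)); first exact: unit_vector_delta.
  rewrite z0 sqrtr0 raddf0 scale0r; apply/rowP => i.
  by rewrite mxE (sqnorm_eq0 z0).
have s0 : Num.sqrt (sqnorm (z 0)) != 0.
  by rewrite sqrtr_eq0 -ltNge lt_def z0 sqnorm_ge0.
exists (of_real K (Num.sqrt (sqnorm (z 0)))^-1 *: z).
  apply/unit_vectorE; rewrite -[RHS](mulVf z0).
  transitivity (modulus (of_real K (Num.sqrt (sqnorm (z 0)))^-1) ^+ 2 * sqnorm (z 0)).
    by rewrite -sqnormZ; apply: eq_sqnorm => i; rewrite mxE.
  rewrite modulus_of_real real_normK ?num_real // exprVn sqr_sqrtr //.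
  exact: sqnorm_ge0.
by rewrite scalerA -rmorphM /= divff // rmorph1 scale1r.
Qed.

Lemma modulus_hdot_unit x y : unit_vector x -> unit_vector y ->
  modulus (hdot (x 0) (y 0)) ^+ 2 <= 1.
Proof.
move=> /unit_vectorE x1 /unit_vectorE y1.
by rewrite -subr_ge0 -x1 -(sqnorm_proj _ y1) sqnorm_ge0.
Qed.

(** Equality in Cauchy-Schwarz: the component of [x] orthogonal to [y] has norm 0. *)
Lemma unit_vector_collinear x y : unit_vector x -> unit_vector y ->
    1 <= modulus (hdot (x 0) (y 0)) ^+ 2 ->
  exists2 c, modulus c = 1 & x = c *: y.
Proof.
move=> x1 y1 xy; have mc : modulus (hdot (x 0) (y 0)) ^+ 2 = 1.
  by apply/eqP; rewrite eq_le xy modulus_hdot_unit.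
exists (hdot (x 0) (y 0)).
  by apply/eqP; rewrite -(@pexpr_eq1 _ _ 2) ?modulus_ge0 // mc.
move: x1 y1 => /unit_vectorE x1 /unit_vectorE y1.
have := sqnorm_proj (x 0) y1; rewrite x1 mc subrr => /sqnorm_eq0 e.
by apply/rowP => i; rewrite mxE; apply/eqP; rewrite -subr_eq0 e.
Qed.

End Vectors.

(** * Multilinear forms *)

Section Forms.
Context {R : realType} {K : base_field} {n k : nat}.
Implicit Types (tau sigma : tensor R K n k) (x y z w : 'rV[scalar_type R K]_n).
Implicit Types (u v : 'I_k -> 'rV[scalar_type R K]_n).

Lemma frobenius_normE tau : frobenius_norm tau = Num.sqrt (sqnorm tau).
Proof. by []. Qed.

Lemma eq_tensor_form tau u v : u =1 v -> tensor_form tau u = tensor_form tau v.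
Proof.
by move=> e; apply: eq_bigr => i _; congr (_ * _); apply: eq_bigr => l _; rewrite e.
Qed.

Lemma tensor_formZ tau (c : 'I_k -> scalar_type R K) u :
  tensor_form tau (fun l => c l *: u l) = (\prod_l c l) * tensor_form tau u.
Proof.
rewrite mulr_sumr; apply: eq_bigr => i _; rewrite mulrCA -big_split /=.
by congr (_ * _); apply: eq_bigr => l _; rewrite mxE.
Qed.

Lemma tensor_form_delta tau (i : {ffun 'I_k -> 'I_n}) :
  tensor_form tau (fun l => delta_mx 0 (i l)) = tau i.
Proof.
rewrite /tensor_form (bigD1 i) //= big1 => [|l _]; last by rewrite mxE !eqxx.
rewrite mulr1 big1 ?addr0 // => j ji.
have [l jl] : exists l, j l != i l.
  apply/existsP; rewrite -negb_forall; apply: contraNN ji => /forallP e.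
  by apply/eqP/ffunP => l; apply/eqP.
by rewrite (bigD1 l) //= mxE (negPf jl) mul0r mulr0.
Qed.

Lemma tensor_form_perm tau u (s : 'S_k) : symmetric_tensor tau ->
  tensor_form tau (fun l => u (s l)) = tensor_form tau u.
Proof.
move=> symt.
pose h (i : {ffun 'I_k -> 'I_n}) := [ffun l => i (s l)].
have h_bij : bijective h.
  exists (fun i : {ffun 'I_k -> 'I_n} => [ffun l => i (s^-1 l)%g]) => i;
    by apply/ffunP => l; rewrite !ffunE ?permKV ?permK.
rewrite /tensor_form (reindex h) /=; last exact: onW_bij.
apply: eq_bigr => i _; rewrite symt; congr (_ * _).
rewrite [RHS](reindex_inj (@perm_inj _ s)) /=.
by apply: eq_bigr => l _; rewrite ffunE.
Qed.

(** This explains the conjugates in [top_eigenpair]: the eigenvalue is the Hermitian coefficient of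
    [tau] along a unit rank-one tensor, so subtracting the eigenpair removes an orthogonal
    projection. *)
Lemma hdot_rank_one tau u :
  hdot tau (rank_one u) =
  tensor_form tau (fun l => map_mx (@conj_scalar R K) (u l)).
Proof.
apply: eq_bigr => i _; congr (_ * _); rewrite ffunE rmorph_prod /=.
by apply: eq_bigr => l _; rewrite mxE.
Qed.

Lemma sqnorm_rank_one u :
  (forall l, unit_vector (u l)) -> sqnorm (rank_one u) = 1.
Proof.
move=> u1; transitivity (\prod_(l < k) sqnorm (u l 0)).
  rewrite /sqnorm bigA_distr_bigA /=; apply: eq_bigr => i _.
  by rewrite ffunE modulus_prod -prodrXl.
by apply: big1 => l _; apply/unit_vectorE.
Qed.

Lemma symmetric_rank_one x : symmetric_tensor (rank_one (fun _ : 'I_k => x)).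
Proof.
move=> s i; rewrite !ffunE [RHS](reindex_inj (@perm_inj _ s)) /=.
by apply: eq_bigr => l _; rewrite ffunE.
Qed.

Lemma symmetric_tensorB tau sigma c : symmetric_tensor tau ->
  symmetric_tensor sigma -> symmetric_tensor (tau - c *: sigma).
Proof.
by move=> ts ss s i; have := (ts s i, ss s i); rewrite !ffunE => -[-> ->].
Qed.

Definition set_pair u (i j : 'I_k) x y : 'I_k -> 'rV[scalar_type R K]_n :=
  fun l => if l == i then x else if l == j then y else u l.

Lemma unit_set_pair u i j x y : (forall l, unit_vector (u l)) ->
  unit_vector x -> unit_vector y -> forall l, unit_vector (set_pair u i j x y l).
Proof. by move=> *; rewrite /set_pair; case: eqP => // _; case: eqP. Qed.

Lemma set_pair_id u i j : set_pair u i j (u i) (u j) =1 u.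
Proof.
by move=> l; rewrite /set_pair; case: eqP => [->//|_]; case: eqP => [->|].
Qed.

(** * Dependence of the form on two of its slots *)

Section Pair.
Context (i j : 'I_k) (i_neq_j : i != j).

(** With the other slots absorbed into a coefficient, the form is visibly bilinear in [x] and [y],
    and identities in them can be checked term by term. *)
Lemma tensor_form_pair tau u x y : tensor_form tau (set_pair u i j x y) =
  \sum_(m : {ffun 'I_k -> 'I_n}) x 0 (m i) * y 0 (m j) *
     (tau m * \prod_(l | (l != i) && (l != j)) u l 0 (m l)).
Proof.
apply: eq_bigr => m _; rewrite (bigD1 i) //= (bigD1 j) 1?eq_sym //=.
rewrite /set_pair eqxx eq_sym (negPf i_neq_j) eqxx.
rewrite (eq_bigr (fun l => u l 0 (m l))); last first.
  by move=> l /andP[/negPf -> /negPf ->].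
ring.
Qed.

Lemma tensor_form_pairC tau u x y : symmetric_tensor tau ->
  tensor_form tau (set_pair u i j x y) = tensor_form tau (set_pair u i j y x).
Proof.
move=> symt; rewrite -(tensor_form_perm (set_pair u i j x y) (tperm i j) symt).
apply: eq_tensor_form => l; rewrite /set_pair.
case: tpermP => [->|->|/eqP/negPf -> /eqP/negPf -> //].
- by rewrite eqxx eq_sym (negPf i_neq_j) eqxx.
- by rewrite eqxx eq_sym (negPf i_neq_j) eqxx.
Qed.

Lemma tensor_form_pairZ tau u c x :
  tensor_form tau (set_pair u i j (c *: x) (c *: x)) =
  c ^+ 2 * tensor_form tau (set_pair u i j x x).
Proof.
rewrite !tensor_form_pair mulr_sumr; apply: eq_bigr => m _; rewrite !mxE; ring.
Qed.

Lemma tensor_form_polarization tau u x y : symmetric_tensor tau ->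
  tensor_form tau (set_pair u i j (x + y) (x + y)) -
  tensor_form tau (set_pair u i j (x - y) (x - y)) =
  4 * tensor_form tau (set_pair u i j x y).
Proof.
move=> symt.
(* Term by term, polarisation produces the sum over both orders of [x] and [y]; the symmetry of
   [tau] identifies the two. *)
have -> : 4 * tensor_form tau (set_pair u i j x y) =
    2 * (tensor_form tau (set_pair u i j x y) + tensor_form tau (set_pair u i j y x)).
  by rewrite (tensor_form_pairC u y x symt); ring.
rewrite !tensor_form_pair -sumrB -big_split mulr_sumr; apply: eq_bigr => m _.
rewrite /= !mxE; ring.
Qed.

End Pair.

(** The squared Frobenius norm of the Gram matrix. On unit vectors it is at most [k ^ 2], with
    equality exactly when they are pairwise collinear. *)
Definition gram u : R :=
  \sum_(a < k) \sum_(b < k) modulus (hdot (u a 0) (u b 0)) ^+ 2.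

(** The interaction of a candidate [x] for slot [i] or [j] with the untouched slots. It is a
    quadratic form in [x], hence obeys the parallelogram law. *)
Definition off_gram u (i j : 'I_k) x : R :=
  \sum_(b < k | (b != i) && (b != j)) modulus (hdot (x 0) (u b 0)) ^+ 2.

Lemma sum_pair_split (g : 'I_k -> 'I_k -> R) (i j : 'I_k) : i != j ->
  (forall a b, g a b = g b a) ->
  \sum_a \sum_b g a b =
    \sum_(a | (a != i) && (a != j)) \sum_(b | (b != i) && (b != j)) g a b +
    2 * (\sum_(b | (b != i) && (b != j)) g i b +
         \sum_(b | (b != i) && (b != j)) g j b) +
    (g i i + g j j + 2 * g i j).
Proof.
move=> ij gC; have ji : j != i by rewrite eq_sym.
have sp (f : 'I_k -> R) :
    \sum_a f a = f i + (f j + \sum_(a | (a != i) && (a != j)) f a).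
  by rewrite (bigD1 i) //= (bigD1 j).
rewrite sp !(sp (g _)) (eq_bigr _ (fun a _ => sp (g a))) !big_split /=.
rewrite (eq_bigr _ (fun a _ => gC a i)) (eq_bigr _ (fun a _ => gC a j)) (gC j i).
ring.
Qed.

(** The first sum is independent of [x] and [y], so it cancels when two choices for the slots [i]
    and [j] are compared. *)
Lemma gram_pair u i j x y : i != j -> (forall l, unit_vector (u l)) ->
    unit_vector x -> unit_vector y ->
  gram (set_pair u i j x y) =
    \sum_(a | (a != i) && (a != j)) \sum_(b | (b != i) && (b != j))
       modulus (hdot (u a 0) (u b 0)) ^+ 2 +
    2 * (off_gram u i j x + off_gram u i j y) +
    (2 + 2 * modulus (hdot (x 0) (y 0)) ^+ 2).
Proof.
move=> ij u1 /unit_vectorE x1 /unit_vectorE y1.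
rewrite /gram (sum_pair_split ij) => [|a b]; last by rewrite hdotC modulus_conj.
have vi : set_pair u i j x y i = x by rewrite /set_pair eqxx.
have vj : set_pair u i j x y j = y by rewrite /set_pair eq_sym (negPf ij) eqxx.
have vl l : (l != i) && (l != j) -> set_pair u i j x y l = u l.
  by rewrite /set_pair => /andP[/negPf -> /negPf ->].
rewrite vi vj !hdot_self x1 y1 !modulus_of_real normr1 expr1n.
congr (_ + _ + _).
  by apply: eq_bigr => a /vl ->; apply: eq_bigr => b /vl ->.
by congr (_ * (_ + _)); apply: eq_bigr => b /vl ->.
Qed.

Lemma off_gramZ u i j c x : off_gram u i j (c *: x) = modulus c ^+ 2 * off_gram u i j x.
Proof.
rewrite mulr_sumr; apply: eq_bigr => b _; rewrite -exprMn -modulusM -hdotZl.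
by congr (modulus _ ^+ 2); apply: eq_bigr => l _; rewrite mxE.
Qed.

Lemma off_gram_parallelogram u i j x y :
  off_gram u i j (x + y) + off_gram u i j (x - y) =
  2 * (off_gram u i j x + off_gram u i j y).
Proof.
rewrite -!big_split mulr_sumr; apply: eq_bigr => b _ /=.
rewrite -modulus_parallelogram -hdotDl -hdotBl.
by congr (_ + _); congr (modulus _ ^+ 2); apply: eq_bigr => l _; rewrite !mxE.
Qed.

End Forms.

(** * Maximisers of symmetric forms *)

Section Banach.
Context {R : realType} {K : base_field} {n k : nat}.
Implicit Types (tau : tensor R K n k) (x y z w : 'rV[scalar_type R K]_n).
Implicit Types (u v : 'I_k -> 'rV[scalar_type R K]_n).

(** Homogeneity of degree two in [z] reduces the bound to unit vectors. *)
Lemma tensor_form_pair_le tau u i j z (lam : R) : (0 < n)%N -> i != j ->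
    (forall l, unit_vector (u l)) ->
    (forall v, (forall l, unit_vector (v l)) -> modulus (tensor_form tau v) <= lam) ->
  modulus (tensor_form tau (set_pair u i j z z)) <= lam * sqnorm (z 0).
Proof.
move=> n0 ij u1 le_lam; have [w w1 zE] := unit_vector_polar z n0.
rewrite {1 2}zE tensor_form_pairZ // modulusM modulusX modulus_of_real.
rewrite real_normK ?num_real // sqr_sqrtr ?sqnorm_ge0 // mulrC.
by rewrite ler_wpM2r ?sqnorm_ge0 //; apply/le_lam/unit_set_pair.
Qed.

Lemma maximizer_collinear tau u i j : (0 < n)%N -> i != j ->
    symmetric_tensor tau ->
    (forall l, unit_vector (u l)) ->
    (forall v, (forall l, unit_vector (v l)) ->
       modulus (tensor_form tau v) <= modulus (tensor_form tau u)) ->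
    (forall v, (forall l, unit_vector (v l)) ->
       modulus (tensor_form tau v) = modulus (tensor_form tau u) ->
       gram v <= gram u) ->
  exists2 c, modulus c = 1 & u i = c *: u j.
Proof.
move=> n0 ij symt u1; set lam := modulus (tensor_form tau u) => maxu maxg.
pose form z := modulus (tensor_form tau (set_pair u i j z z)).
have sum4 : sqnorm ((u i + u j) 0) + sqnorm ((u i - u j) 0) = 4.
  have := sqnorm_parallelogram (u i 0) (u j 0).
  have /unit_vectorE -> := u1 i; have /unit_vectorE -> := u1 j.
  rewrite (_ : 2 * (1 + 1) = 4) => [<-|]; last by ring.
  by congr (_ + _); apply: eq_sqnorm => l; rewrite !mxE.
have form_le z : form z <= lam * sqnorm (z 0) by exact: tensor_form_pair_le.
have ge_form : 4 * lam <= form (u i + u j) + form (u i - u j).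
  rewrite /form -(modulusN (tensor_form _ (set_pair _ _ _ (_ - _) _))).
  apply: le_trans (ler_modulusD _ _).
  rewrite tensor_form_polarization // (eq_tensor_form _ (set_pair_id u i j)).
  by rewrite modulusM -(rmorph_nat (of_real K) 4) modulus_of_real normr_nat.
(* The upper bounds [form_le] for the sum and the difference add up to [4 * lam], which is also the
   lower bound [ge_form]; hence both are equalities. *)
have formP : form (u i + u j) = lam * sqnorm ((u i + u j) 0).
  have := form_le (u i + u j); have := form_le (u i - u j); nra.
have formM : form (u i - u j) = lam * sqnorm ((u i - u j) 0).
  have := form_le (u i + u j); have := form_le (u i - u j); nra.
(* If [z] attains its bound, its normalisation [w] in both slots gives another maximiser. The
   inequality is [gram (set_pair u i j w w) <= gram u] multiplied by [sqnorm (z 0)], a form that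
   also makes sense for [z = 0]. *)
have off_le z : form z = lam * sqnorm (z 0) ->
    4 * off_gram u i j z + 4 * sqnorm (z 0) <=
    sqnorm (z 0) * (2 * (off_gram u i j (u i) + off_gram u i j (u j)) +
                    2 * modulus (hdot (u i 0) (u j 0)) ^+ 2 + 2).
  have [w w1 zE] := unit_vector_polar z n0.
  have [z0 _|z0] := eqVneq (sqnorm (z 0)) 0.
    by rewrite z0 zE z0 sqrtr0 raddf0 off_gramZ modulus0 expr0n !mul0r !mulr0 addr0.
  rewrite /form {1 2 4}zE tensor_form_pairZ // off_gramZ modulusM modulusX.
  rewrite modulus_of_real real_normK ?num_real // sqr_sqrtr ?sqnorm_ge0 //.
  rewrite [lam * _]mulrC => /(mulfI z0) wmax.
  have := maxg (set_pair u i j w w) (unit_set_pair i j u1 w1 w1) wmax.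
  rewrite gram_pair //.
  have -> : gram u = gram (set_pair u i j (u i) (u j)).
    by congr gram; apply/funext => l; rewrite set_pair_id.
  rewrite gram_pair // hdot_self; move: (w1) => /unit_vectorE ->.
  rewrite modulus_of_real normr1 expr1n => le_gram.
  rewrite mulrCA [4 * sqnorm _]mulrC -mulrDr ler_wpM2l ?sqnorm_ge0 //.
  lra.
apply: unit_vector_collinear; rewrite ?u1 //.
(* Summing over [u i + u j] and [u i - u j], the [off_gram] terms cancel by the parallelogram law,
   leaving 16 at most 8 plus 8 times the squared modulus of the product of [u i] and [u j]. *)
have := off_le _ formP; have := off_le _ formM.
have := off_gram_parallelogram u i j (u i) (u j).
set s := sqnorm _ in sum4 *; set s' := sqnorm _ in sum4 *.
have -> : s = 4 - s' by lra.
nra.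
Qed.

End Banach.

(** * Compactness of tuples of unit vectors *)

Section UnitTuples.
Local Open Scope classical_set_scope.

(** The maximisers of [f] form a closed part of the compact set [A], so [g] attains its maximum on
    them. *)
Lemma compact_lex_argmax (R : realType) (T : topologicalType) (A : set T)
    (f g : T -> R) : A !=set0 -> compact A -> continuous f -> continuous g ->
  exists c, [/\ A c, forall x, A x -> f x <= f c &
    forall x, A x -> f x = f c -> g x <= g c].
Proof.
move=> A0 cA cf cg.
have [c /set_mem Ac maxf] :=
  compact_EVT_max A0 cA (continuous_subspaceT cf).
have cB : compact (A `&` [set x | f x = f c]).
  apply: compact_closedI => //.
  by apply: (@closed_comp _ _ f [set f c]) => //; exact: closed_eq.
have [d /set_mem[Ad fd] maxg] :=
  compact_EVT_max (ex_intro _ c (conj Ac erefl)) cB (continuous_subspaceT cg).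
exists d; split=> // x Ax; rewrite fd; first exact/maxf/mem_set.
by move=> fx; apply/maxg/mem_set.
Qed.

Section RealContinuity.
Context {R : realType} {T : topologicalType}.
Implicit Types f g : T -> R.

Lemma real_continuousD f g :
  continuous f -> continuous g -> continuous (fun x => f x + g x).
Proof. by move=> cf cg x; apply: (cvgD (cf x) (cg x)). Qed.

Lemma real_continuousB f g :
  continuous f -> continuous g -> continuous (fun x => f x - g x).
Proof. by move=> cf cg x; apply: (cvgB (cf x) (cg x)). Qed.

Lemma real_continuousM f g :
  continuous f -> continuous g -> continuous (fun x => f x * g x).
Proof. by move=> cf cg x; apply: (cvgM (cf x) (cg x)). Qed.

End RealContinuity.

(** * Continuity and compactness in real coordinates *)

Section Coordinates.
Context {R : realType} {K : base_field}.

Section ScalarContinuity.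
Context {T : topologicalType}.
Implicit Types f g : T -> scalar_type R K.

(** Stated through real coordinates, so that both fields are treated at once and only the topology
    of [R] is involved. *)
Definition scalar_continuous f : Prop :=
  continuous (fun x => re_scalar (f x)) /\ continuous (fun x => im_scalar (f x)).

Lemma scalar_continuous_cst (c : scalar_type R K) : scalar_continuous (fun=> c).
Proof. by split=> x; exact: cst_continuous. Qed.

Lemma scalar_continuousD f g : scalar_continuous f -> scalar_continuous g ->
  scalar_continuous (fun x => f x + g x).
Proof.
move=> [fr fi] [gr gi]; split.
- under [X in continuous X]eq_fun do rewrite raddfD /=.
  exact: real_continuousD.
- under [X in continuous X]eq_fun do rewrite raddfD /=.
  exact: real_continuousD.
Qed.

Lemma scalar_continuousM f g : scalar_continuous f -> scalar_continuous g ->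
  scalar_continuous (fun x => f x * g x).
Proof.
move=> [fr fi] [gr gi]; split.
- under [X in continuous X]eq_fun do rewrite re_scalarM.
  by apply: real_continuousB; exact: real_continuousM.
- under [X in continuous X]eq_fun do rewrite im_scalarM.
  by apply: real_continuousD; exact: real_continuousM.
Qed.

Lemma scalar_continuous_conj f : scalar_continuous f ->
  scalar_continuous (fun x => conj_scalar (f x)).
Proof.
move=> [fr fi]; split.
- by under [X in continuous X]eq_fun do rewrite re_conj.
- under [X in continuous X]eq_fun do rewrite im_conj.
  by move=> x; apply: (cvgN (fi x)).
Qed.

Lemma scalar_continuous_sum (I : Type) (r : seq I) (P : pred I)
    (f : I -> T -> scalar_type R K) :
  (forall i, scalar_continuous (f i)) ->
  scalar_continuous (fun x => \sum_(i <- r | P i) f i x).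
Proof.
move=> fc; rewrite -fct_sumE.
by elim/big_ind: _ => //; [exact: scalar_continuous_cst|exact: scalar_continuousD].
Qed.

Lemma scalar_continuous_prod (I : Type) (r : seq I) (P : pred I)
    (f : I -> T -> scalar_type R K) :
  (forall i, scalar_continuous (f i)) ->
  scalar_continuous (fun x => \prod_(i <- r | P i) f i x).
Proof.
move=> fc; rewrite -fct_prodE.
by elim/big_ind: _ => //; [exact: scalar_continuous_cst|exact: scalar_continuousM].
Qed.

Lemma continuous_modulus_sqr f : scalar_continuous f ->
  continuous (fun x => modulus (f x) ^+ 2).
Proof.
move=> [fr fi]; under [X in continuous X]eq_fun do rewrite modulus_sqr !expr2.
by apply: real_continuousD; exact: real_continuousM.
Qed.

Lemma continuous_real_sum (I : Type) (r : seq I) (P : pred I) (f : I -> T -> R) :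
  (forall i, continuous (f i)) ->
  continuous (fun x => \sum_(i <- r | P i) f i x).
Proof.
move=> fc; rewrite -fct_sumE.
elim/big_ind: _ => [x|g h gc hc|//]; first exact: cst_continuous.
exact: real_continuousD.
Qed.

End ScalarContinuity.

Section Decode.
Context {n k : nat}.

(** A product of real lines, so that Tychonoff's theorem applies. An index consists of a slot, an
    entry, and a boolean that is true for the imaginary part. *)
Definition coordinates : Type :=
  prod_topology (fun _ : 'I_k * 'I_n * bool => R : topologicalType).

HB.instance Definition _ := Topological.on coordinates.

Definition decode (x : coordinates) (l : 'I_k) : 'rV[scalar_type R K]_n :=
  \row_i mk_scalar K (x (l, i, false)) (x (l, i, true)).

Definition encode (u : 'I_k -> 'rV[scalar_type R K]_n) : coordinates :=
  fun p => if p.2 then im_scalar (u p.1.1 0 p.1.2) else re_scalar (u p.1.1 0 p.1.2).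

Lemma encodeK : cancel encode decode.
Proof.
by move=> u; apply/funext => l; apply/rowP => i; rewrite mxE mk_scalarK.
Qed.

Lemma scalar_continuous_decode l i : scalar_continuous (fun x => decode x l 0 i).
Proof.
have projc p : continuous (fun x : coordinates => x p : R).
  by move=> x; exact: (@proj_continuous _ (fun _ : 'I_k * 'I_n * bool => R : topologicalType) p).
split.
- under [X in continuous X]eq_fun do rewrite mxE re_mk_scalar; exact: projc.
- under [X in continuous X]eq_fun do rewrite mxE im_mk_scalar.
  case: K; [move=> x; exact: cst_continuous|exact: projc].
Qed.

Lemma continuous_sqnorm_decode l : continuous (fun x => sqnorm (decode x l 0)).
Proof.
apply: continuous_real_sum => i; apply: continuous_modulus_sqr.
exact: scalar_continuous_decode.
Qed.

(* The cube bounds the imaginary coordinates, which [decode] ignores for real scalars. *)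
Definition unit_coordinates : set coordinates :=
  [set x | forall p, -1 <= x p <= 1] `&`
  [set x | forall l, unit_vector (decode x l)].

Lemma compact_unit_coordinates : compact unit_coordinates.
Proof.
apply: compact_closedI.
  have := @tychonoff _ (fun _ : 'I_k * 'I_n * bool => R : topologicalType)
    (fun=> `[-1, 1]) (fun=> @segment_compact R (-1) 1).
  by congr compact; apply/seteqP; split=> x /= xP p; have := xP p; rewrite /= in_itv.
rewrite (_ : mkset _ = \bigcap_(l in setT) [set x | sqnorm (decode x l 0) = 1]).
  apply: closed_bigI => l _.
  apply: (@closed_comp _ _ (fun x => sqnorm (decode x l 0)) [set 1]).
    by move=> x _; exact: continuous_sqnorm_decode.
  exact: closed_eq.
by apply/seteqP; split=> x /= xP l; [move=> _|]; apply/unit_vectorE/xP.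
Qed.

Lemma encode_unit u :
  (forall l, unit_vector (u l)) -> unit_coordinates (encode u).
Proof.
move=> u1; split; last by move=> l; rewrite encodeK.
move=> [[l i] b] /=; rewrite -ler_norml /encode /=.
have /unit_vectorE ul := u1 l.
have le1 : modulus (u l 0 i) ^+ 2 <= 1.
  by rewrite -ul /sqnorm (bigD1 i) //= lerDl sumr_ge0 // => j _; rewrite sqr_ge0.
rewrite -(@ler_pXn2r _ 2) ?nnegrE ?normr_ge0 // expr1n real_normK ?num_real //.
apply: le_trans le1; rewrite modulus_sqr.
by case: b; rewrite ?lerDl ?lerDr sqr_ge0.
Qed.

Lemma unit_lex_argmax (f g : ('I_k -> 'rV[scalar_type R K]_n) -> R) :
    (0 < n)%N -> continuous (f \o decode) -> continuous (g \o decode) ->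
  exists u, [/\ forall l, unit_vector (u l),
    forall v, (forall l, unit_vector (v l)) -> f v <= f u &
    forall v, (forall l, unit_vector (v l)) -> f v = f u -> g v <= g u].
Proof.
move=> n0 cf cg.
have ne : unit_coordinates !=set0.
  exists (encode (fun=> delta_mx 0 (Ordinal n0))).
  by apply: encode_unit => l; exact: unit_vector_delta.
have [c [[_ c1] maxf maxg]] := compact_lex_argmax ne compact_unit_coordinates cf cg.
exists (decode c); split=> // v /encode_unit v1.
  by have := maxf _ v1; rewrite /= encodeK.
by have := maxg _ v1; rewrite /= encodeK.
Qed.

(** The square is polynomial in the coordinates and has the same maximisers as the modulus. *)
Lemma continuous_tensor_form (tau : tensor R K n k) :
  continuous ((fun u => modulus (tensor_form tau u) ^+ 2) \o decode).
Proof.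
apply: continuous_modulus_sqr; apply: scalar_continuous_sum => m.
apply: scalar_continuousM; first exact: scalar_continuous_cst.
by apply: scalar_continuous_prod => l; exact: scalar_continuous_decode.
Qed.

Lemma continuous_gram : continuous (gram \o decode).
Proof.
apply: continuous_real_sum => a; apply: continuous_real_sum => b.
apply: continuous_modulus_sqr; apply: scalar_continuous_sum => i.
apply: scalar_continuousM; first exact: scalar_continuous_decode.
by apply: scalar_continuous_conj; exact: scalar_continuous_decode.
Qed.

End Decode.
End Coordinates.

End UnitTuples.

(** * Top eigenpairs and the greedy algorithm *)

Section TopEigenpair.
Context {R : realType} {K : base_field} {n k : nat} (n_gt0 : (0 < n)%N).
Implicit Types (tau : tensor R K n k).
Implicit Types (u v : 'I_k -> 'rV[scalar_type R K]_n).

Lemma lambda_maxE tau u : (forall l, unit_vector (u l)) ->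
    (forall v, (forall l, unit_vector (v l)) ->
       modulus (tensor_form tau v) <= modulus (tensor_form tau u)) ->
  lambda_max tau = modulus (tensor_form tau u).
Proof.
move=> u1 maxu; apply/eqP; rewrite eq_le; apply/andP; split.
- by apply: ge_sup => [|_ [v v1 <-]]; [exists (modulus (tensor_form tau u)); exists u|exact: maxu].
- apply: ub_le_sup; last by exists u.
  by exists (modulus (tensor_form tau u)) => _ [v v1 <-]; exact: maxu.
Qed.

(** Take the maximiser that is best for [gram]. For symmetric [tau] its factors are unimodular
    multiples of a single vector, and dropping these phases leaves the modulus of the form
    unchanged. *)
Lemma lambda_max_attained tau :
  exists u, [/\ forall l, unit_vector (u l),
    forall v, (forall l, unit_vector (v l)) ->
      modulus (tensor_form tau v) <= modulus (tensor_form tau u) &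
    symmetric_tensor tau -> exists x, forall l, u l = x].
Proof.
have [u [u1 maxu maxg]] :=
  unit_lex_argmax n_gt0 (@continuous_tensor_form R K n k tau) (@continuous_gram R K n k).
have {}maxu v : (forall l, unit_vector (v l)) ->
    modulus (tensor_form tau v) <= modulus (tensor_form tau u).
  by move=> /maxu; rewrite ler_pXn2r ?nnegrE ?modulus_ge0.
have [symt|] := pselect (symmetric_tensor tau); last by exists u; split.
(* Without slots any vector serves as the common factor; otherwise slot 0 is the reference. *)
have [k0|k0] := posnP k.
  exists u; split=> // _; exists (delta_mx 0 (Ordinal n_gt0)) => l.
  by have := leq_ltn_trans (leq0n l) (ltn_ord l); rewrite k0.
pose l0 := Ordinal k0.
have colin l : exists c, modulus c = 1 /\ u l = c *: u l0.
  have [->|ll0] := eqVneq l l0; first by exists 1; rewrite modulus1 scale1r.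
  have [|c] := maximizer_collinear n_gt0 ll0 symt u1 maxu; last by exists c.
  by move=> v v1 vE; apply: maxg => //; rewrite vE.
have [c cP] := choice colin.
exists (fun=> u l0); split=> //; last by exists (u l0).
suff -> : modulus (tensor_form tau (fun=> u l0)) = modulus (tensor_form tau u) by [].
rewrite [in RHS](eq_tensor_form _ (fun l => (cP l).2)) tensor_formZ modulusM.
by rewrite modulus_prod big1 ?mul1r // => l _; case: (cP l).
Qed.

Lemma le_lambda_max tau v : (forall l, unit_vector (v l)) ->
  modulus (tensor_form tau v) <= lambda_max tau.
Proof.
move=> v1; have [u [u1 maxu _]] := lambda_max_attained tau.
by rewrite (lambda_maxE u1 maxu) maxu.
Qed.

Lemma lambda_max_gt0 tau : tau != 0 -> 0 < lambda_max tau.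
Proof.
move=> t0; have [i ti] : exists i, tau i != 0.
  apply/existsP; rewrite -negb_forall; apply: contraNN t0 => /forallP e.
  by apply/eqP/ffunP => i; rewrite ffunE; apply/eqP.
apply: (lt_le_trans _ (le_lambda_max tau (v := fun l => delta_mx 0 (i l)) _)).
  rewrite tensor_form_delta lt_def modulus_ge0 andbT.
  by apply: contraNneq ti => /modulus_eq0 ->.
by move=> l; exact: unit_vector_delta.
Qed.

(** The same phase [w] in every slot multiplies the form by [w ^+ k], which makes the value real and
    keeps equal factors equal. The vectors are then conjugated, since an eigenpair evaluates the
    form at conjugates. *)
Lemma exists_top_eigenpair tau : (0 < k)%N ->
  exists p : R * ('I_k -> 'rV[scalar_type R K]_n),
  [/\ top_eigenpair tau (of_real K p.1) p.2,
      K = ComplexField \/ (K = RealField /\ odd k) -> 0 <= p.1 &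
      symmetric_tensor tau -> exists x, forall l, p.2 l = x].
Proof.
move=> k0; have [u [u1 maxu symu]] := lambda_max_attained tau.
have [w [r [w1 wr r0]]] := exists_phase (tensor_form tau u) k0.
exists (r, fun l => map_mx (@conj_scalar R K) (w *: u l)); split=> //=.
- split=> [l||].
  + by apply/unit_vector_conj/unit_vectorZ.
  + rewrite -wr; transitivity (tensor_form tau (fun l => w *: u l)).
      by rewrite tensor_formZ prodr_const card_ord.
    by apply: eq_tensor_form => l; apply/rowP => i; rewrite !mxE conj_scalarK.
  + by rewrite (lambda_maxE u1 maxu) -wr modulusM modulusX w1 expr1n mul1r.
- move=> /symu [x ux]; exists (map_mx (@conj_scalar R K) (w *: x)) => l.
  by rewrite ux.
Qed.

End TopEigenpair.

(** * The residuals of the greedy algorithm and their energy *)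

Section Greedy.
Context {R : realType} {K : base_field} {n k : nat} (n_gt0 : (0 < n)%N).
Context (eigen : tensor R K n k -> R * ('I_k -> 'rV[scalar_type R K]_n)).
Context (eigenP : forall sigma : tensor R K n k,
  top_eigenpair sigma (of_real K (eigen sigma).1) (eigen sigma).2).
Context (tau : tensor R K n k).

(** What is left after [m] steps. Steps are numbered from 0 here but from 1 in [partial_sum], whence
    the predecessors [j.-1] below. *)
Definition residual (m : nat) : tensor R K n k :=
  iter m (fun sigma => sigma - of_real K (eigen sigma).1 *: rank_one (eigen sigma).2) tau.

Definition eigen_val (m : nat) : R := (eigen (residual m)).1.
Definition eigen_vec (m : nat) : 'I_k -> 'rV[scalar_type R K]_n :=
  (eigen (residual m)).2.

Lemma residualS m : residual m.+1 =
  residual m - of_real K (eigen_val m) *: rank_one (eigen_vec m).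
Proof. by []. Qed.

Lemma residual_partial_sum m :
  tau - partial_sum (fun j => eigen_val j.-1) (fun j => eigen_vec j.-1) m =
  residual m.-1.
Proof.
(* Both [m = 0] and [m = 1] give an empty sum and the residual of index 0. *)
case: m => [|m]; first by rewrite /partial_sum big_geq // subr0.
elim: m => [|m IH]; first by rewrite /partial_sum big_geq // subr0.
by rewrite /partial_sum big_nat_recr //= opprD addrA IH.
Qed.

Lemma sqnorm_residualS m :
  sqnorm (residual m.+1) = sqnorm (residual m) - eigen_val m ^+ 2.
Proof.
have [u1 lamE _] := eigenP (residual m).
rewrite -hdot_rank_one in lamE.
have := sqnorm_proj (residual m) (sqnorm_rank_one u1).
rewrite -lamE modulus_of_real real_normK ?num_real // => <-.
by apply: eq_sqnorm => i; rewrite !ffunE.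
Qed.

Lemma lambda_max_residual m : lambda_max (residual m) = `|eigen_val m|.
Proof. by have [_ _ <-] := eigenP (residual m); rewrite modulus_of_real. Qed.

(** The product with a unit rank-one tensor is a value of the form at unit vectors, hence bounded by
    [lambda_max (residual b)], whether [m] precedes [b] or not. *)
Lemma hdot_residual_eigen_vec b m :
  `|re_scalar (hdot (residual b) (rank_one (eigen_vec m)))| <= `|eigen_val b|.
Proof.
apply: le_trans (ler_re_modulus _) _.
rewrite hdot_rank_one -lambda_max_residual; apply: le_lambda_max => // l.
by have [u1 _ _] := eigenP (residual m); exact/unit_vector_conj/u1.
Qed.

Lemma le_sqnorm_residual a c : (a <= c)%N ->
  sqnorm (residual c) <= sqnorm (residual a).
Proof.
move=> /subnKC <-; elim: (c - a)%N => [|d IH]; first by rewrite addn0.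
by rewrite addnS sqnorm_residualS lerBlDr (le_trans IH) // lerDl sqr_ge0.
Qed.

(** Each of the [c - a] steps lowers the energy by [eigen_val m ^+ 2], which is at least
    [eigen_val b ^+ 2]. *)
Lemma eigen_val_block a b c : (a <= c)%N ->
    (forall m, (a <= m < c)%N -> `|eigen_val b| <= `|eigen_val m|) ->
  (c - a)%:R * eigen_val b ^+ 2 <= sqnorm (residual a) - sqnorm (residual c).
Proof.
move=> /subnKC <-; rewrite addKn; elim: (c - a)%N => [|d IH] le_b.
  by rewrite mul0r addn0 subrr.
rewrite addnS sqnorm_residualS -natr1 mulrDl mul1r.
have /IH : forall m, (a <= m < a + d)%N -> `|eigen_val b| <= `|eigen_val m|.
  by move=> m /andP[am md]; rewrite le_b // am addnS ltnW.
have : eigen_val b ^+ 2 <= eigen_val (a + d) ^+ 2.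
  rewrite -(real_normK (num_real (eigen_val b))).
  rewrite -(real_normK (num_real (eigen_val (a + d)))).
  by rewrite ler_pXn2r ?nnegrE // le_b // leq_addr addnS leqnn.
lra.
Qed.

(* Each rank-one term between [a] and [b] correlates with [residual b] by at most
   [lambda_max (residual b) = `|eigen_val b|], hence by at most its own weight. *)
Lemma hdot_residualB a b c : (a <= c)%N ->
    (forall m, (a <= m < c)%N -> `|eigen_val b| <= `|eigen_val m|) ->
  `|re_scalar (hdot (residual a - residual c) (residual b))| <=
    sqnorm (residual a) - sqnorm (residual c).
Proof.
move=> /subnKC <-; elim: (c - a)%N => [|d IH] le_b.
  rewrite addn0 !subrr /hdot big1 ?raddf0 ?normr0 // => i _.
  by rewrite ffunE mul0r.
have /IH {}IH : forall m, (a <= m < a + d)%N -> `|eigen_val b| <= `|eigen_val m|.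
  by move=> m /andP[am md]; rewrite le_b // am addnS ltnW.
have -> : hdot (residual a - residual (a + d.+1)) (residual b) =
    hdot (residual a - residual (a + d)) (residual b) +
    of_real K (eigen_val (a + d)) * hdot (rank_one (eigen_vec (a + d))) (residual b).
  rewrite -hdotZl -hdotDl; apply: eq_bigr => i _; congr (_ * _).
  by rewrite addnS residualS !ffunE opprB addrA addrAC.
rewrite raddfD /= re_of_realM addnS sqnorm_residualS.
have term_le : `|eigen_val (a + d) *
    re_scalar (hdot (rank_one (eigen_vec (a + d))) (residual b))| <=
    eigen_val (a + d) ^+ 2.
  rewrite re_hdotC normrM -(real_normK (num_real (eigen_val (a + d)))) expr2.
  rewrite ler_wpM2l // (le_trans (hdot_residual_eigen_vec _ _)) //.
  by rewrite le_b // leq_addr addnS leqnn.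
by apply: le_trans (ler_normD _ _) _; lra.
Qed.

(** Expand the square of the first residual as the difference plus [residual b]. The cross term
    occurs twice and each copy costs at most the energy drop, so the constant is 1 + 2. *)
Lemma sqnorm_residualB a b : (a <= b)%N ->
    (forall m, (a <= m < b)%N -> `|eigen_val b| <= `|eigen_val m|) ->
  sqnorm (residual a - residual b) <=
    3 * (sqnorm (residual a) - sqnorm (residual b)).
Proof.
move=> ab le_b; have := hdot_residualB ab le_b; rewrite ler_norml => /andP[dot_ge _].
have : sqnorm (residual a) = sqnorm (residual a - residual b) +
    sqnorm (residual b) + 2 * re_scalar (hdot (residual a - residual b) (residual b)).
  have split_c f : hdot (residual a) f =
      hdot (residual a - residual b) f + hdot (residual b) f.
    by rewrite -hdotDl; apply: eq_bigr => i _; rewrite !ffunE subrK.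
  rewrite !sqnormE split_c !raddfD /= (re_hdotC _ (residual a)).
  rewrite (re_hdotC (residual b) (residual a)) !split_c !raddfD /=.
  rewrite (re_hdotC (residual b) (residual a - residual b)).
  ring.
lra.
Qed.

End Greedy.

(** * Perturbed coefficients and blocks of small energy *)

Section Perturbation.
Context {R : realType} {K : base_field} {n k : nat}.
Implicit Types (sigma : tensor R K n k) (U : nat -> 'I_k -> 'rV[scalar_type R K]_n).

(** The triangle inequality for a rank-one perturbation: expand the square and apply Cauchy-Schwarz
    to the cross term. *)
Lemma frobenius_norm_rank_oneB sigma (c : R) (u : 'I_k -> 'rV[scalar_type R K]_n) :
    (forall l, unit_vector (u l)) ->
  frobenius_norm (sigma - of_real K c *: rank_one u) <= frobenius_norm sigma + `|c|.
Proof.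
move=> /sqnorm_rank_one X1; rewrite !frobenius_normE.
set s := Num.sqrt (sqnorm sigma); have s0 : 0 <= s by exact: sqrtr_ge0.
have s2 : s ^+ 2 = sqnorm sigma by rewrite sqr_sqrtr ?sqnorm_ge0.
have dot_le : `|re_scalar (hdot sigma (rank_one u))| <= s.
  apply: le_trans (ler_re_modulus _) _.
  rewrite -(@ler_pXn2r _ 2) ?nnegrE ?modulus_ge0 // s2 -subr_ge0.
  by rewrite -sqnorm_proj ?sqnorm_ge0.
rewrite -[leRHS]ger0_norm ?addr_ge0 // -sqrtr_sqr ler_wsqrtr //.
have -> : sqnorm (sigma - of_real K c *: rank_one u) =
    s ^+ 2 - 2 * (c * re_scalar (hdot sigma (rank_one u))) + c ^+ 2.
  have split_l f : hdot (sigma - of_real K c *: rank_one u) f =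
      hdot sigma f - of_real K c * hdot (rank_one u) f.
    by rewrite -hdotBZl; apply: eq_bigr => i _; rewrite !ffunE.
  rewrite sqnormE split_l raddfB /= re_of_realM (re_hdotC sigma).
  rewrite (re_hdotC (rank_one u)) !split_l !raddfB /= !re_of_realM.
  rewrite (re_hdotC (rank_one u) sigma) -!sqnormE X1 s2; ring.
have : - (c * re_scalar (hdot sigma (rank_one u))) <= `|c| * s.
  by rewrite (le_trans (ler_norm _)) // normrN normrM ler_wpM2l.
rewrite sqrrD -[`|c| ^+ 2]normrX [`|c ^+ 2|]ger0_norm ?sqr_ge0 // -mulr_natl.
lra.
Qed.

Lemma frobenius_norm_partial_sumB sigma (c : nat -> R) U (m : nat) (delta : R) :
    (forall j l, unit_vector (U j l)) -> (forall j, `|c j| <= delta) ->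
  frobenius_norm (sigma - partial_sum c U m) <=
    frobenius_norm sigma + m.-1%:R * delta.
Proof.
move=> U1 c_le; case: m => [|m] /=.
  by rewrite /partial_sum big_geq // subr0 mul0r addr0.
elim: m => [|m IH]; first by rewrite /partial_sum big_geq // subr0 mul0r addr0.
rewrite /partial_sum big_nat_recr //= opprD addrA -/(partial_sum c U m.+1).
apply: le_trans (frobenius_norm_rank_oneB _ _ (U1 _)) _.
by rewrite -natr1 mulrDl mul1r addrA lerD.
Qed.

Lemma partial_sumB (a b : nat -> R) U m :
  partial_sum (fun j => a j - b j) U m =
  partial_sum a U m - partial_sum b U m :> tensor R K n k.
Proof.
rewrite /partial_sum -sumrB; apply: eq_bigr => j _.
by rewrite raddfB /= scalerBl.
Qed.

(** Vanishing coefficients are replaced by a small [delta], and the change is absorbed into [Rem],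
    whose strict bound leaves room for it; [Q] stays the same. *)
Lemma positive_regularity_decomposition (F : nat -> nat) (eps : R)
    (tau : tensor R K n k) (t : nat) (lam : nat -> R) U (Rem Q : tensor R K n k) :
    (forall j l, unit_vector (U j l)) -> (forall j, 0 <= lam j) ->
    regularity_decomposition F eps tau t lam U Rem Q ->
  exists (lam' : nat -> R) (Rem' : tensor R K n k),
    regularity_decomposition F eps tau t lam' U Rem' Q /\ forall j, 0 < lam' j.
Proof.
move=> U1 lam0 [tauE _ RemE QE].
pose slack := eps * frobenius_norm tau - frobenius_norm Rem.
have slack0 : 0 < slack by rewrite subr_gt0.
(* At most [(F t).-1] terms change, each by at most [delta] in norm, so the total stays below
   [slack]; the successor keeps the denominator positive. *)
pose delta := slack / (F t).+1%:R.
have delta0 : 0 < delta by rewrite divr_gt0 ?ltr0Sn.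
pose lam' j := if lam j == 0 then delta else lam j.
exists lam', (Rem - partial_sum (fun j => lam' j - lam j) U (F t)); split; last first.
  by move=> j; rewrite /lam'; case: eqP => // /eqP lj; rewrite lt_def lj lam0.
split=> //.
- by rewrite tauE partial_sumB opprB addrCA subrKC [Rem + _]addrC.
- apply: le_lt_trans (frobenius_norm_partial_sumB (delta := delta) _ _ U1 _) _.
    move=> j; rewrite /lam'; case: eqP => [->|_]; first by rewrite subr0 gtr0_norm.
    by rewrite subrr normr0 ltW.
  rewrite -ltrBrDl -/slack /delta mulrCA gtr_pMr // ltr_pdivrMr ?ltr0Sn //.
  by rewrite mul1r ltr_nat ltnS leq_pred.
Qed.

End Perturbation.

(** Otherwise each of the [T] drops would be at least [eta], and so their telescoping sum at least
    [T%:R * eta]. *)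
Lemma exists_small_block {R : realType} (f : nat -> R) (T : nat) (eta : R) :
    (0 < T)%N -> f 1 - f T.+1 < T%:R * eta ->
  exists2 t, (1 <= t <= T)%N & f t - f t.+1 < eta.
Proof.
move=> T0 fT; have [//|nex] := pselect (exists2 t, (1 <= t <= T)%N & f t - f t.+1 < eta).
exfalso; move: fT; rewrite ltNge => /negP; apply.
have : \sum_(1 <= t < T.+1) eta <= \sum_(1 <= t < T.+1) (f t - f t.+1).
  rewrite !big_nat; apply: ler_sum => t tT.
  by rewrite leNgt; apply/negP => h; apply: nex; exists t.
rewrite sumr_const_nat subSS subn0 -[eta *+ T]mulr_natl => h; apply: le_trans h _.
rewrite -[leRHS]opprB -telescope_sumr // -sumrN.
by rewrite (eq_bigr _ (fun t _ => opprB (f t.+1) (f t))).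
Qed.

Lemma exists_block_min {R : realType} (f : nat -> R) (a c : nat) : (a < c)%N ->
  exists2 b, (a <= b < c)%N & forall m, (a <= m < c)%N -> f b <= f m.
Proof.
move=> ac; have d0 : (0 < c - a)%N by rewrite subn_gt0.
have [i _ min_i] := arg_minP (fun i : 'I_(c - a) => f (a + i)%N) (isT : xpredT (Ordinal d0)).
exists (a + i)%N.
  by rewrite leq_addr -ltn_subRL ltn_ord.
move=> m /andP[am mc].
have mi : (m - a < c - a)%N by rewrite ltn_sub2r.
by have := min_i (Ordinal mi) isT; rewrite /= subnKC.
Qed.

(** * Assembly of the decompositions *)

Theorem theorem8 (R : realType) (K : base_field) (n k : nat) (F : nat -> nat)
    (hk : (2 <= k)%N) (hF : {homo F : a b / (a < b)%N})
    (eps : R) (heps : 0 < eps) (tau : tensor R K n k) (htau : tau != 0) :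
  exists t : nat,
    [/\ (1 <= t)%N,
        t%:Z <= Num.ceil (4 / eps ^+ 2),
        (exists (lam : nat -> R) (u : nat -> 'I_k -> 'rV[scalar_type R K]_n)
                (Rem Q : tensor R K n k),
          [/\ regularity_decomposition F eps tau t lam u Rem Q,
              (forall j, (1 <= j < F t)%N ->
                 top_eigenpair (tau - partial_sum lam u j) (of_real K (lam j)) (u j)),
              (symmetric_tensor tau -> equal_factors F t u) &
              (K = ComplexField \/ (K = RealField /\ odd k) ->
                 forall j, (1 <= j < F t)%N ->
                   tau - partial_sum lam u j != 0 -> 0 < lam j)]) &
        (K = ComplexField \/ (K = RealField /\ odd k) ->
          exists (lam : nat -> R) (u : nat -> 'I_k -> 'rV[scalar_type R K]_n)
                 (Rem Q : tensor R K n k),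
          [/\ regularity_decomposition F eps tau t lam u Rem Q,
              (symmetric_tensor tau -> equal_factors F t u) &
              (forall j, (1 <= j < F t)%N -> 0 < lam j)])].
Proof.
have k0 : (0 < k)%N by exact: ltnW.
(* For [n = 0] and [k > 0] there are no multi-indices, so [tau] would be zero. *)
have n0 : (0 < n)%N.
  rewrite lt0n; apply: contraNneq htau => n0; apply/eqP/ffunP => i.
  by exfalso; have := leq_ltn_trans (leq0n _) (ltn_ord (i (Ordinal k0))); rewrite n0.
have [eigen eigenP] := choice (fun sigma : tensor R K n k => exists_top_eigenpair n0 sigma k0).
have topP sigma : top_eigenpair sigma (of_real K (eigen sigma).1) (eigen sigma).2.
  by case: (eigenP sigma).
pose r := residual eigen tau; pose l := eigen_val eigen tau.
pose E m := sqnorm (r m).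
have E0 : 0 < E 0.
  rewrite lt_def sqnorm_ge0 andbT; apply: contraNneq htau => E0.
  by apply/eqP/ffunP => i; rewrite ffunE (sqnorm_eq0 E0).
(* The number of indices [j] with [1 <= j < F t], so that [r (G t)] is the residual after all terms
   of the sum. *)
pose G t := (F t).-1.
have F_gt0 t : (0 < t)%N -> (0 < F t)%N.
  by move=> t0; exact: leq_ltn_trans (leq0n (F 0)) (hF _ _ t0).
have F_G t : (0 < t)%N -> F t = (G t).+1 by move=> t0; rewrite /G prednK ?F_gt0.
have G_lt t : (0 < t)%N -> (G t < G t.+1)%N.
  by move=> t0; rewrite -ltnS -!F_G // hF.
have ceil0 : 0 < Num.ceil (4 / eps ^+ 2) by rewrite ceil_gt0 divr_gt0 ?exprn_gt0.
pose T := `|Num.ceil (4 / eps ^+ 2)|%N.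
have TE : T%:Z = Num.ceil (4 / eps ^+ 2) by rewrite gez0_abs // ltW.
have T0 : (0 < T)%N by rewrite -ltz_nat TE.
have T_ge : 4 / eps ^+ 2 <= T%:R.
  by rewrite -[T%:R]/(T%:Z%:~R) TE ceil_ge.
(* The divisor 3 compensates the constant in [sqnorm_residualB]. Since [T] is at least
   [4 / eps ^+ 2], the [T] thresholds add up to at least [4 / 3 * E 0], more than the total
   energy. *)
have [|t /andP[t1 tT] small] :=
    @exists_small_block _ (fun t => E (G t)) T (eps ^+ 2 * E 0 / 3) T0.
  have E1 : E (G 1) <= E 0 by exact: le_sqnorm_residual.
  have E2 : 0 <= E (G T.+1) by exact: sqnorm_ge0.
  move: T_ge; rewrite ler_pdivrMr ?exprn_gt0 // => /(ler_wpM2r (ltW E0)).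
  lra.
have [b /andP[ab bc] min_b] := exists_block_min (fun m => `|l m|) (G_lt t t1).
have Ebc : E (G t.+1) <= E b by exact/le_sqnorm_residual/ltnW.
have Rle : sqnorm (r (G t) - r b) <= 3 * (E (G t) - E b).
  apply: sqnorm_residualB => // m /andP[am mb].
  by rewrite min_b // am (ltn_trans mb).
(* The predecessors in [G] cancel, so the block has exactly [F t.+1 - F t] steps. *)
have Qle : (F t.+1 - F t)%:R * l b ^+ 2 <= E (G t) - E (G t.+1).
  rewrite !F_G // subSS; apply: eigen_val_block => //.
  exact/ltnW/G_lt.
have epsE : eps * frobenius_norm tau = Num.sqrt (eps ^+ 2 * E 0).
  by rewrite sqrtrM ?sqr_ge0 // sqrtr_sqr gtr0_norm.
have epsE0 : 0 < eps ^+ 2 * E 0 by rewrite mulr_gt0 ?exprn_gt0.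
pose lam j := l j.-1; pose U j := eigen_vec eigen tau j.-1.
have resE j : tau - partial_sum lam U j = r j.-1 by exact: residual_partial_sum.
have U1 j i : unit_vector (U j i) by have [u1 _ _] := topP (r j.-1); exact: u1.
have decomp : regularity_decomposition F eps tau t lam U (r (G t) - r b) (r b).
  split=> [|j i _||].
  - by rewrite -addrA subrK -resE addrC subrK.
  - exact: U1.
  - by rewrite frobenius_normE epsE ltr_sqrt //; lra.
  (* After clearing the denominator and squaring, this follows from [Qle] and [small]. *)
  - rewrite (lambda_max_residual topP) epsE ltr_pdivlMr; last first.
      by rewrite sqrtr_gt0 ltr0n subn_gt0 hF.
    rewrite -sqrtr_sqr -sqrtrM ?sqr_ge0 // ltr_sqrt // mulrC.
    lra.
(* A symmetric residual has an eigenpair with equal factors, whose rank-one tensor is symmetric; so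
   the next residual is symmetric too. *)
have sym_r : symmetric_tensor tau -> forall m, symmetric_tensor (r m).
  move=> symt; elim=> [//|m IH]; rewrite /r residualS.
  apply: symmetric_tensorB => //.
  have [_ _ /(_ IH) [x xE]] := eigenP (r m).
  suff -> : eigen_vec eigen tau m = (fun=> x) by exact: symmetric_rank_one.
  exact/funext.
have eq_factors : symmetric_tensor tau -> equal_factors F t U.
  by move=> symt j _; have [_ _] := eigenP (r j.-1); apply; exact: sym_r.
exists t; split=> //.
- by rewrite -TE lez_nat.
- exists lam, U, (r (G t) - r b), (r b); split=> //.
  + by move=> j _; rewrite resE; exact: topP.
  (* A non-zero residual has a positive top eigenvalue, so the non-negative [lam j] cannot
     vanish. *)
  + move=> pos j _; rewrite resE => rj.
    have [_ /(_ pos) lam_ge0 _] := eigenP (r j.-1).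
    rewrite lt_def lam_ge0 andbT -normr_gt0.
    by rewrite -(lambda_max_residual topP) lambda_max_gt0.
(* A zero residual has only the top eigenvalue 0, so coefficients that are positive throughout come
   from a second, perturbed decomposition. *)
- move=> pos; have lam_ge0 j : 0 <= lam j.
    by have [_ /(_ pos)] := eigenP (r j.-1).
  have [lam' [Rem' [decomp' lam'_gt0]]] :=
    positive_regularity_decomposition U1 lam_ge0 decomp.
  by exists lam', U, Rem', (r b); split.
Qed.
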